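(* Let $A\in\mathbb M_m$ be a Perron-like matrix with principal eigenvalue $s=s(A)$, let $\delta>0$ be such that $\mathrm{Re}\,\mu\le s-2\delta$ for all $\mu\in\sigma(A)\setminus\{s\}$, and let $V=[v_i]_{i\in J}\in\mathbb M_m$ be nonsingular with $\|V\|=1$. Put $y_i=\Pi_1v_i$, $Y=[y_i]_{i\in J}$, and, with $\kappa$ as in the context, $$X_n(t)=\sum_{k=0}^n\frac{t^k}{k!}A^kV,\qquad \vartheta_n(t)=\kappa^{-1}e^{2\|A\|t}\left(\frac{e\|A\|t}{n+1}\right)^{n+1}.$$ Assume that $s$ is semisimple. Then there exist positive constants $B_1,B_2$ such that for all $n\in\mathbb N$ and all $t\ge1$ (with $X_n(t)\ne0$, so that the left-hand sides are defined), $$\left\|\frac{X_n(t)}{\|X_n(t)\|}-\frac{Y}{\|Y\|}\right\|\le B_1e^{-\delta t}+\vartheta_n(t)\,o(1)$$ and $$\left|\frac1{\|X_n(t)\|^2}\langle AX_n(t),X_n(t)\rangle-s\right|\le B_2e^{-\delta t}+\|A\|\vartheta_n(t)\,o(1),$$ where $o(1)$ is an infinitesimal as $n\to\infty$ which depends only upon $n$.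
   Context: $J=\{1,\dots,m\}$; $\mathbb N$ is the set of nonnegative integers. $\mathbb M_m$ is the space of real $m\times m$ matrices; $[\alpha_i]_{i\in J}$ denotes the matrix with columns $\alpha_i$. $\mathbb R^m$ carries the Euclidean inner product and norm; on $\mathbb M_m$, $\langle[\alpha_i],[\beta_i]\rangle=\sum_{i\in J}\langle\alpha_i,\beta_i\rangle$ and $\|M\|=\langle M,M\rangle^{1/2}$. $\sigma(A)$ is the set of (complex) eigenvalues of $A$, $s(A)=\max\{\mathrm{Re}\,\mu:\mu\in\sigma(A)\}$. $A$ is Perron-like if $s:=s(A)\in\sigma(A)$ and $\mathrm{Re}\,\mu<s$ for all $\mu\in\sigma(A)\setminus\{s\}$; $s$ is then called the principal eigenvalue. $\mathrm{E}_s(A)=\ker(A-sI)$; $\mathrm{GE}_s(A)=\{\xi\in\mathbb R^m:(A-sI)^k\xi=0\text{ for some }k\ge1\}$; $s$ is semisimple if $\mathrm{GE}_s(A)=\mathrm{E}_s(A)$. For any $\mu\in\sigma(A)$, $\mathrm{GE}_\mu(A)\subset\mathbb R^m$ is the set of all real and imaginary parts of vectors $u\in\mathbb C^m$ with $(A-\mu I)^ku=0$ for some $k\ge1$. Then $\mathbb R^m=E_1\oplus E_2$ with $E_1=\mathrm{GE}_s(A)$, $E_2=\sum_{\mu\in\sigma(A)\setminus\{s\}}\mathrm{GE}_\mu(A)$, and $\Pi_1$ is the projection onto $E_1$ along $E_2$. $\kappa>0$ is a constant such that (in the semisimple case) $e^{-st}\|e^{tA}V\|\ge\kappa$ for all $t\ge1$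 and $\|Y\|\ge\kappa$ (such a constant exists). *)

(* Defs.v *)
From HB Require Import structures.
From mathcomp Require Import all_boot all_order all_algebra.
From mathcomp Require Import all_classical all_reals all_analysis.
From mathcomp Require Import complex.

Set Implicit Arguments.
Unset Strict Implicit.
Unset Printing Implicit Defensive.

Import Order.TTheory GRing.Theory Num.Theory.
Import numFieldNormedType.Exports.

Local Open Scope classical_set_scope.
Local Open Scope complex_scope.
Local Open Scope ring_scope.

Section EuclideanStructure.
Context {R : realType} {m : nat}.

Definition mxdot (M N : 'M[R]_m) : R := \sum_j \sum_i M i j * N i j.

(* Not MathComp-Analysis's norm on matrices, which is the maximum of the
   absolute values of the entries. *)
Definition fnorm (M : 'M[R]_m) : R := Num.sqrt (mxdot M M).

(* The limit is taken in the topology of entrywise convergence. *)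
Definition mexp (M : 'M[R]_m) : 'M[R]_m :=
  limn (series (fun k => (k`!%:R)^-1 *: M ^+ k)).

End EuclideanStructure.

Section Spectrum.
Context {R : realType} {m : nat}.
Implicit Types (A : 'M[R]_m).

Definition complexify A : 'M[R[i]]_m := map_mx (real_complex R) A.

(* [eigenvalue] refers to row eigenvectors; the set of eigenvalues is the same
   as for column eigenvectors, since M and M^T have the same characteristic
   polynomial. *)
Definition spectrum A : set R[i] :=
  [set mu | eigenvalue (complexify A) mu].

(* The supremum is a maximum when m > 0, the spectrum being then finite and
   nonempty. *)
Definition spectral_abscissa A : R := sup [set complex.Re mu | mu in spectrum A].

Definition perron_like A : Prop :=
  let s := spectral_abscissa A in
  spectrum A s%:C /\
  forall mu, spectrum A mu -> mu <> s%:C -> complex.Re mu < s.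

Definition real_eigenspace A (a : R) : set 'cV[R]_m :=
  [set xi | (A - a%:M) *m xi = 0].

Definition real_gen_eigenspace A (a : R) : set 'cV[R]_m :=
  [set xi | exists2 k, (0 < k)%N & (A - a%:M) ^+ k *m xi = 0].

Definition semisimple_at A (a : R) : Prop :=
  real_gen_eigenspace A a = real_eigenspace A a.

Definition gen_eigenspace_parts A (mu : R[i]) : set 'cV[R]_m :=
  [set w | exists (u : 'cV[R[i]]_m) (k : nat),
     [/\ (0 < k)%N, (complexify A - mu%:M) ^+ k *m u = 0 &
         w = map_mx (@complex.Re R) u \/ w = map_mx (@complex.Im R) u]].

Definition principal_space A : set 'cV[R]_m :=
  real_gen_eigenspace A (spectral_abscissa A).

(* The sum, over the eigenvalues mu other than s(A), of the spaces
   [gen_eigenspace_parts A mu]. *)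
Definition complementary_space A : set 'cV[R]_m :=
  [set w | exists2 ws : seq 'cV[R]_m,
     (forall x, x \in ws -> exists mu, [/\ spectrum A mu,
        mu <> (spectral_abscissa A)%:C & gen_eigenspace_parts A mu x]) &
     w = \sum_(x <- ws) x].

(* The projection onto [principal_space A] along [complementary_space A]; the
   default value 0 is never used for a Perron-like A, as R^m is then the direct
   sum of these two spaces. *)
Definition principal_proj A (v : 'cV[R]_m) : 'cV[R]_m :=
  xget 0 [set y | principal_space A y /\ complementary_space A (v - y)].

Definition principal_part A (V : 'M[R]_m) : 'M[R]_m :=
  \matrix_(i, j) principal_proj A (col j V) i 0.

Definition taylor_sol A (V : 'M[R]_m) (n : nat) (t : R) : 'M[R]_m :=
  \sum_(k < n.+1) (t ^+ k / k`!%:R) *: (A ^+ k *m V).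

Definition vartheta A (kappa : R) (n : nat) (t : R) : R :=
  kappa^-1 * expR (2 * fnorm A * t)
  * (expR 1 * fnorm A * t / n.+1%:R) ^+ n.+1.

End Spectrum.

(* Main.v *)
(* Write W(t) = e^{tA} V and a = |A|, and let s be the principal eigenvalue.

   Semisimplicity gives A Y = s Y, and by the primary decomposition V - Y is a
   sum of real and imaginary parts of generalized eigenvectors for eigenvalues
   of real part at most s - 2 delta. Along those, e^{tA} is O(e^{(s - delta) t})
   by a Gronwall estimate, which absorbs the polynomial factors. Hence
   |e^{-st} W(t) - Y| <= K e^{-delta t}.

   The Taylor remainder satisfies |W(t) - X_n(t)| <= (a t)^N / N! e^{at} with
   N = n + 1, while |W(t)| >= kappa e^{st} and |s| <= a. So the relative error is
   at most 2 kappa^{-1} e^{2at} (a t)^N / N!, which is vartheta_n(t) times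
   2 N^N / (e^N N!), and this factor tends to 0 and depends only on n.

   The Rayleigh quotient follows from <A x, x> - s = <(A - s)(x - y), x> for the
   unit vectors x = X / |X| and y = Y / |Y|. *)

Require Import Defs.
From HB Require Import structures.
From mathcomp Require Import all_boot all_order all_algebra.
From mathcomp Require Import all_classical all_reals all_analysis.
From mathcomp Require Import complex.
From mathcomp Require Import ring lra.

Set Implicit Arguments.
Unset Strict Implicit.
Unset Printing Implicit Defensive.

Import Order.TTheory GRing.Theory Num.Theory.
Import numFieldNormedType.Exports.

Local Open Scope classical_set_scope.
Local Open Scope complex_scope.
Local Open Scope ring_scope.

(** * Cauchy-Schwarz and the Frobenius norm *)

(** The sum of the squares of Sb a_i - Sab b_i is nonnegative and equals Sb (Sa Sb - Sab^2).
    Dividing by Sb leaves the case Sb = 0, where every b_i vanishes. *)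
Lemma sum_CauchySchwarz (R : realFieldType) (I : finType) (a b : I -> R) :
  (\sum_i a i * b i) ^+ 2 <= (\sum_i a i ^+ 2) * (\sum_i b i ^+ 2).
Proof.
set Sab := \sum_i _; set Sa := \sum_i _; set Sb := \sum_i _.
have Sb0 : 0 <= Sb by apply: sumr_ge0 => i _; exact: sqr_ge0.
have : 0 <= \sum_i (Sb * a i - Sab * b i) ^+ 2.
  by apply: sumr_ge0 => i _; exact: sqr_ge0.
have -> : \sum_i (Sb * a i - Sab * b i) ^+ 2 = Sb * (Sa * Sb - Sab ^+ 2).
  have E (u v p q : R) : (u * p - v * q) ^+ 2 =
      u ^+ 2 * p ^+ 2 - (2 * u * v) * (p * q) + v ^+ 2 * q ^+ 2 by ring.
  under eq_bigr => i _ do rewrite E.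
  by rewrite big_split sumrB -!mulr_sumr -/Sab -/Sa -/Sb /=; ring.
have [Sb_eq0 _|Sb_neq0] := eqVneq Sb 0; last first.
  by rewrite pmulr_rge0 ?subr_ge0// lt_def Sb_neq0.
have b0 i : b i = 0.
  move/eqP: Sb_eq0; rewrite psumr_eq0 => [|j _]; last exact: sqr_ge0.
  by move=> /allP/(_ i); rewrite mem_index_enum sqrf_eq0 => /(_ isT)/eqP.
rewrite /Sab big1 => [|i _]; last by rewrite b0 mulr0.
by rewrite expr0n mulr_ge0// sumr_ge0// => i _; exact: sqr_ge0.
Qed.

Section FrobeniusNorm.
Context {R : realType} {m : nat}.
Implicit Types (M N : 'M[R]_m).

Lemma mxdotE M N : mxdot M N = \sum_(p : 'I_m * 'I_m) M p.2 p.1 * N p.2 p.1.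
Proof. by rewrite /mxdot pair_big. Qed.

Lemma mxdot_ge0 M : 0 <= mxdot M M.
Proof. by rewrite mxdotE sumr_ge0// => p _; rewrite -expr2 sqr_ge0. Qed.

Lemma fnorm_ge0 M : 0 <= fnorm M.
Proof. exact: sqrtr_ge0. Qed.

Lemma fnorm_sqr M : fnorm M ^+ 2 = mxdot M M.
Proof. by rewrite sqr_sqrtr// mxdot_ge0. Qed.

Lemma mxdotC M N : mxdot M N = mxdot N M.
Proof. by rewrite !mxdotE; apply: eq_bigr => p _; rewrite mulrC. Qed.

Lemma mxdotDl M1 M2 N : mxdot (M1 + M2) N = mxdot M1 N + mxdot M2 N.
Proof.
rewrite !mxdotE -big_split; apply: eq_bigr => p _ /=.
by rewrite !mxE mulrDl.
Qed.

Lemma mxdotZl a M N : mxdot (a *: M) N = a * mxdot M N.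
Proof.
rewrite !mxdotE mulr_sumr; apply: eq_bigr => p _ /=.
by rewrite !mxE mulrA.
Qed.

Lemma normr_mxdot_le M N : `|mxdot M N| <= fnorm M * fnorm N.
Proof.
rewrite -ler_sqr ?nnegrE ?mulr_ge0 ?fnorm_ge0// real_normK ?num_real//.
rewrite exprMn !fnorm_sqr !mxdotE.
under [X in _ <= X * _]eq_bigr => i _ do rewrite -expr2.
under [X in _ <= _ * X]eq_bigr => i _ do rewrite -expr2.
exact: sum_CauchySchwarz.
Qed.

Lemma fnorm_triangle M N : fnorm (M + N) <= fnorm M + fnorm N.
Proof.
rewrite -ler_sqr ?nnegrE ?addr_ge0 ?fnorm_ge0// sqrrD !fnorm_sqr.
rewrite mxdotDl (mxdotC M (M + N)) (mxdotC N (M + N)) !mxdotDl (mxdotC N M).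
have := le_trans (ler_norm _) (normr_mxdot_le M N); lra.
Qed.

Lemma fnormZ a M : fnorm (a *: M) = `|a| * fnorm M.
Proof.
by rewrite /fnorm mxdotZl mxdotC mxdotZl mulrA -expr2 sqrtrM ?sqr_ge0//
  sqrtr_sqr.
Qed.

Lemma fnormN M : fnorm (- M) = fnorm M.
Proof. by rewrite -scaleN1r fnormZ normrN1 mul1r. Qed.

Lemma fnormB M N : fnorm (M - N) = fnorm (N - M).
Proof. by rewrite -fnormN opprB. Qed.

Lemma fnorm0 : fnorm (0 : 'M[R]_m) = 0.
Proof. by rewrite -(scale0r 0) fnormZ normr0 mul0r. Qed.

Lemma fnorm_eq0 M : (fnorm M == 0) = (M == 0).
Proof.
apply/eqP/eqP => [M0|->]; last exact: fnorm0.
have : mxdot M M == 0 by rewrite -fnorm_sqr M0 expr0n.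
rewrite mxdotE psumr_eq0 => [|p _]; last by rewrite -expr2 sqr_ge0.
move=> /allP Mp; apply/matrixP => i j; rewrite mxE.
by have := Mp (j, i); rewrite mem_index_enum mulf_eq0 orbb => /(_ isT)/eqP.
Qed.

Lemma fnorm_gt0 M : (0 < fnorm M) = (M != 0).
Proof. by rewrite lt_def fnorm_ge0 fnorm_eq0 andbT. Qed.

(** Cauchy-Schwarz bounds the square of each entry of the product by (row of M)^2 (column of N)^2,
    and these bounds sum to the product of the squared norms. *)
Lemma fnorm_mulmx M N : fnorm (M *m N) <= fnorm M * fnorm N.
Proof.
rewrite -ler_sqr ?nnegrE ?mulr_ge0 ?fnorm_ge0// exprMn !fnorm_sqr.
pose c (j : 'I_m) := \sum_k N k j ^+ 2; pose r (i : 'I_m) := \sum_k M i k ^+ 2.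
have -> : mxdot M M * mxdot N N = \sum_j \sum_i r i * c j.
  rewrite /mxdot exchange_big mulr_sumr; apply: eq_bigr => j _.
  rewrite mulr_suml; apply: eq_bigr => i _.
  by congr (_ * _); apply: eq_bigr => k _; rewrite -expr2.
apply: ler_sum => j _; apply: ler_sum => i _.
by rewrite -expr2 mxE; exact: sum_CauchySchwarz.
Qed.

(** The factor N makes k = 0 harmless: the identity has Frobenius norm sqrt m, so |M^k| <= |M|^k may
    fail there. *)
Lemma fnorm_mulXmx M N k : fnorm (M ^+ k *m N) <= fnorm M ^+ k * fnorm N.
Proof.
elim: k => [|k ih]; first by rewrite !expr0 mul1mx mul1r.
rewrite !exprS -mulmxE -mulmxA -mulrA (le_trans (fnorm_mulmx _ _))//.
by rewrite ler_wpM2l ?fnorm_ge0.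
Qed.

Lemma normr_coord_le M i j : `|M i j| <= fnorm M.
Proof.
rewrite -ler_sqr ?nnegrE ?fnorm_ge0// real_normK ?num_real// fnorm_sqr mxdotE.
rewrite (bigD1 (j, i))//= -expr2 lerDl sumr_ge0// => p _.
by rewrite -expr2 sqr_ge0.
Qed.

Lemma fnorm_le_coord M (b : R) : (forall i j, `|M i j| <= b) -> fnorm M <= m%:R
  * b.
Proof.
(* In dimension 0 no entry is available to give 0 <= b, but both sides are 0. *)
case: m M => [M _|m' M Mb];
  first by rewrite [M]thinmx0 mul0r /fnorm /mxdot big_ord0 sqrtr0.
have b0 : 0 <= b := le_trans (normr_ge0 _) (Mb ord0 ord0).
rewrite -ler_sqr ?nnegrE ?mulr_ge0 ?sqrtr_ge0// sqr_sqrtr; last first.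
  by apply: sumr_ge0 => j _; apply: sumr_ge0 => i _; rewrite -expr2 sqr_ge0.
apply: (@le_trans _ _ (\sum_(j < m'.+1) \sum_(i < m'.+1) b ^+ 2)).
  apply: ler_sum => j _; apply: ler_sum => i _.
  by rewrite -expr2 -[leLHS]real_normK ?num_real// ler_sqr.
by rewrite !sumr_const card_ord -mulrnA -[leLHS]mulr_natl exprMn natrM expr2.
Qed.

(** Replace M by N at the fixed scale 1/|N|, then account for the change of scale on M. Each costs
    |M - N| / |N|, the second by the reverse triangle inequality. Only |N| is left in the
    denominator, so a lower bound on N alone suffices. *)
Lemma fnorm_normalize_le M N : M != 0 -> N != 0 ->
  fnorm ((fnorm M)^-1 *: M - (fnorm N)^-1 *: N) <= 2 * (fnorm (M - N) / fnorm
    N).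
Proof.
rewrite -!fnorm_gt0 => M0 N0.
have -> : (fnorm M)^-1 *: M - (fnorm N)^-1 *: N =
  (fnorm N)^-1 *: (M - N) + ((fnorm M)^-1 - (fnorm N)^-1) *: M.
  by rewrite scalerBr scalerBl [RHS]addrC addrA subrK.
rewrite (le_trans (fnorm_triangle _ _))// !fnormZ mulr2n mulrDl mul1r.
rewrite ger0_norm ?invr_ge0 ?fnorm_ge0// [_^-1 * _]mulrC lerD2l.
have -> : (fnorm M)^-1 - (fnorm N)^-1 = (fnorm N - fnorm M) / (fnorm M * fnorm
  N).
  by field; rewrite !gt_eqF.
rewrite normrM normfV (ger0_norm (mulr_ge0 (ltW M0) (ltW N0))).
set d := `|_ - _|; have -> : d / (fnorm M * fnorm N) * fnorm M = d / fnorm N.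
  by field; rewrite !gt_eqF.
rewrite ler_wpM2r ?invr_ge0 ?fnorm_ge0//.
have h1 := fnorm_triangle (M - N) N; have h2 := fnorm_triangle (N - M) M.
by move: h1 h2; rewrite !subrK (fnormB N) ler_norml; lra.
Qed.

End FrobeniusNorm.

(** * A weak form of Stirling's formula *)

(* For r_N = N! e^N / N^N one has r_{N+1} / r_N = e / (1 + 1/N)^N >= e^{1/(6N)},
   whose sixth power is at least (N + 1) / N; hence r_N >= N^{1/6}. *)
Lemma expr_fact_exp_bound (R : realType) (n : nat) :
  n.+1%:R * (n.+1%:R ^+ n.+1) ^+ 6 <= (expR (n.+1%:R : R) * n.+1`!%:R) ^+ 6.
Proof.
elim: n => [|n ih].
  by rewrite !expr1n !mul1r mulr1 exprn_ege1// -[leLHS]expR0 ler_expR.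
set x : R := n.+1%:R in ih *.
have x0 : 0 < x by rewrite ltr0n.
have xS : n.+2%:R = x + 1 :> R by rewrite -natr1.
have y1 : x^-1 <= 1 by rewrite invf_le1// ler1n.
have y0 : 0 < x^-1 by rewrite invr_gt0.
set y := x^-1 in y0 y1.
have yx : y * x = 1 by rewrite mulVf ?gt_eqF.
(* With z = y - y^2/6, the bound e^z >= 1 + z is too weak. Squaring e^(z/2) >= 1 + z/2 gains z^2/4,
   which outweighs y^2/6 for y <= 1 because 25/144 > 1/6. *)
have y_exp : 1 + y <= expR (y - y ^+ 2 / 6).
  have -> : y - y ^+ 2 / 6 = (y - y ^+ 2 / 6) / 2 + (y - y ^+ 2 / 6) / 2 by
    field.
  rewrite expRD -expr2.
  apply: (@le_trans _ _ ((1 + (y - y ^+ 2 / 6) / 2) ^+ 2)).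
    rewrite -subr_ge0.
    have -> : (1 + (y - y ^+ 2 / 6) / 2) ^+ 2 - (1 + y) =
      y ^+ 2 * ((1 - y / 6) ^+ 2 / 4 - 6^-1) by field.
    by apply: mulr_ge0; [exact: sqr_ge0|nra].
  by rewrite ler_sqr ?nnegrE ?expR_ge0 ?expR_ge1Dx//; nra.
(* Since x y = 1, the exponents add up to y + 6 (1 - y/6) = 6: the sixth power is what absorbs the
   extra factor 1 + y. *)
have growth : (1 + y) * ((1 + y) ^+ n.+1) ^+ 6 <= expR 1 ^+ 6.
  apply: (@le_trans _ _ (expR y * (expR (y - y ^+ 2 / 6) ^+ n.+1) ^+ 6)).
    have y1_ge0 : 0 <= 1 + y by rewrite addr_ge0 ?ler01 ?ltW.
    apply: ler_pM; rewrite ?expR_ge1Dx ?exprn_ge0//.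
    by rewrite lerXn2r ?nnegrE ?exprn_ge0 ?expR_ge0// lerXn2r ?nnegrE ?expR_ge0.
  rewrite -!expRM_natl -expRD ler_expR -/x.
  suff -> : y + 6%:R * (x * (y - y ^+ 2 / 6)) = 6%:R * 1 by [].
  by rewrite /y; field; rewrite gt_eqF.
rewrite xS (exprS _ n.+1) (factS n.+1) natrM xS expRD.
have -> : x + 1 = x * (1 + y) by rewrite mulrDr mulr1 mulrC mulrC [x * y]mulrC
  yx.
rewrite (exprMn n.+1).
(* With x (1 + y) for the next integer, its sixth power splits off both sides; what remains is the
   induction hypothesis times [growth]. *)
have -> : x * (1 + y) * (x * (1 + y) * (x ^+ n.+1 * (1 + y) ^+ n.+1)) ^+ 6 =
  (x * (1 + y)) ^+ 6 * ((x * (x ^+ n.+1) ^+ 6) * ((1 + y) * ((1 + y) ^+ n.+1)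
    ^+ 6)).
  by rewrite !exprMn; ring.
have -> : (expR x * expR 1 * (x * (1 + y) * n.+1`!%:R)) ^+ 6 =
  (x * (1 + y)) ^+ 6 * ((expR x * n.+1`!%:R) ^+ 6 * expR 1 ^+ 6).
  by rewrite -!exprMn; congr (_ ^+ _); ring.
have p0 : 0 <= 1 + y by rewrite addr_ge0 ?ler01 ?ltW.
have {}x0 := ltW x0.
apply: ler_wpM2l; first by rewrite exprn_ge0 ?mulr_ge0.
by apply: ler_pM => //; rewrite mulr_ge0 ?exprn_ge0.
Qed.

(** With N = n + 1, this is the ratio of 1/N!, from the Taylor remainder, to (e/N)^N, from
    [vartheta]. *)
Definition stirling_gap {R : realType} (n : nat) : R :=
  n.+1%:R ^+ n.+1 / (expR n.+1%:R * n.+1`!%:R).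

(** The sixth power is at most 1/(n + 1); comparing it with e^6 avoids taking roots. *)
Lemma cvg_stirling_gap (R : realType) : stirling_gap @ \oo --> (0 : R).
Proof.
have d0 n : 0 < expR n.+1%:R * n.+1`!%:R :> R by rewrite mulr_gt0 ?expR_gt0
  ?ltr0n ?fact_gt0.
have g0 n : 0 <= stirling_gap n :> R by rewrite divr_ge0 ?exprn_ge0 ?ltW.
have bnd n : stirling_gap n ^+ 6 <= harmonic n :> R.
  rewrite /harmonic /= expr_div_n ler_pdivrMr ?exprn_gt0// mulrC ler_pdivlMr
    ?ltr0n//.
  by rewrite mulrC; exact: expr_fact_exp_bound.
apply/cvgrPdist_lt => e e0; near=> n.
rewrite sub0r normrN ger0_norm// -(@ltr_pXn2r _ 6) ?nnegrE ?g0 ?(ltW e0)//.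
apply: le_lt_trans (bnd n) _.
near: n.
have := @cvg_harmonic R => /cvgrPdist_lt/(_ (e ^+ 6));
  rewrite exprn_gt0// => /(_ isT).
apply: filterS => n; rewrite sub0r normrN ger0_norm// harmonic_ge0.
Unshelve. all: by end_near. Qed.

(** * Entrywise limits and the matrix exponential *)

Lemma cvg_mx_coord (K : numFieldType) m n (f : nat -> 'M[K]_(m, n)) (L :
  'M[K]_(m, n)) :
  (forall i j, (fun k => f k i j) @ \oo --> L i j) -> f @ \oo --> L.
Proof.
move=> fL B [P PL sB].
have : \forall k \near \oo, forall i j, P i j (f k i j).
  by apply: filter_forall => i; apply: filter_forall => j; exact: fL (PL i j).
by apply: filterS => k Pf; exact: sB.
Qed.

Lemma cvg_sum_fin (K : numFieldType) (I : finType) (f : I -> nat -> K) (l : I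
  -> K) :
  (forall i, f i @ \oo --> l i) -> (fun n => \sum_i f i n) @ \oo --> \sum_i l i.
Proof. by move=> fl; apply: cvg_big => [|i _];
  [exact: add_continuous|exact: fl]. Qed.

Section MatrixExponential.
Context {R : realType} {m : nat}.
Implicit Types (A V : 'M[R]_m).

Lemma exprZmx (t : R) A k : (t *: A) ^+ k = t ^+ k *: A ^+ k.
Proof.
elim: k => [|k ih]; first by rewrite !expr0 scale1r.
by rewrite !exprS ih -!mulmxE -scalemxAl -scalemxAr scalerA.
Qed.

(** These are the Taylor coefficients of the scalar function t -> (e^{tA} w)_ij. They reduce
    convergence and differentiation of the exponential to scalar power series. *)
Definition mexp_coeff p A (w : 'M[R]_(m, p)) i j (k : nat) : R :=
  (k`!%:R)^-1 * (A ^+ k *m w) i j.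

(** Differentiating termwise cancels k + 1 against (k + 1)! and leaves one more factor A, which is
    absorbed into w. *)
Lemma pseries_diffs_mexp_coeff p A (w : 'M[R]_(m, p)) i j :
  pseries_diffs (mexp_coeff A w i j) = mexp_coeff A (A *m w) i j.
Proof.
apply/funext => k; rewrite /pseries_diffs /mexp_coeff exprSr -mulmxE -mulmxA
  mulrA.
by rewrite factS natrM invfM mulrA divff ?mul1r// pnatr_eq0.
Qed.

Lemma is_cvg_pseries_mexp_coeff p A (w : 'M[R]_(m, p)) i j t :
  cvgn (pseries (mexp_coeff A w i j) t).
Proof.
apply: normed_cvg.
(* The norm of the identity appears because A^k is bounded as A^k times 1; the sum over l bounds
   column j of w. The series is then dominated by C e^{|A| |t|}. *)
pose C : R := fnorm (1%:M : 'M[R]_m) * \sum_l `|w l j|.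
apply: (@series_le_cvg _ _ (fun k => C * exp_coeff (fnorm A * `|t|) k)) =>
  [k|k|k|].
- exact: normr_ge0.
- by rewrite /exp_coeff/= !mulr_ge0 ?sumr_ge0 ?fnorm_ge0 ?exprn_ge0 ?mulr_ge0
  ?fnorm_ge0// invr_ge0.
- have Aw_le : `|(A ^+ k *m w) i j| <= C * fnorm A ^+ k.
    rewrite mxE (le_trans (ler_norm_sum _ _ _))// /C mulrAC mulr_sumr.
    apply: ler_sum => l _;
      rewrite normrM ler_wpM2r// (le_trans (normr_coord_le _ _ _))//.
    by rewrite -[A ^+ k]mulmx1 mulrC fnorm_mulXmx.
  rewrite /= /mexp_coeff /exp_coeff/= !normrM normfV normrX normr_nat.
  have -> : C * ((fnorm A * `|t|) ^+ k / k`!%:R) =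
      k`!%:R^-1 * (C * fnorm A ^+ k) * `|t| ^+ k by rewrite exprMn; ring.
  by rewrite ler_wpM2r ?exprn_ge0// ler_wpM2l ?invr_ge0.
- by apply: is_cvg_seriesZ; exact: is_cvg_series_exp_coeff.
Qed.

Lemma mexp_coord A t i j : mexp (t *: A) i j = limn (pseries (mexp_coeff A 1%:M
  i j) t).
Proof.
suff : (series (fun k => (k`!%:R)^-1 *: (t *: A) ^+ k)) @ \oo -->
    (\matrix_(i, j) limn (pseries (mexp_coeff A 1%:M i j) t)).
  by move=> /cvg_lim; rewrite /mexp => ->//; rewrite mxE.
apply: cvg_mx_coord => {}i {}j; rewrite mxE.
rewrite (_ : (fun _ => _) = pseries (mexp_coeff A 1%:M i j) t);
  first exact: is_cvg_pseries_mexp_coeff.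
apply/funext => n; rewrite /pseries /series/= summxE; apply: eq_bigr => k _.
by rewrite /mexp_coeff mulmx1 exprZmx !mxE mulrA mulrAC.
Qed.

Lemma cvg_pseries_mexp p A (w : 'M[R]_(m, p)) i j t :
  pseries (mexp_coeff A w i j) t @ \oo --> (mexp (t *: A) *m w) i j.
Proof.
rewrite mxE.
rewrite (_ : pseries _ t = fun n => \sum_l pseries (mexp_coeff A 1%:M i l) t n
  * w l j); last first.
  apply/funext => n; rewrite /pseries /series/=.
  under [RHS]eq_bigr => l _ do rewrite mulr_suml.
  rewrite exchange_big; apply: eq_bigr => k _;
    rewrite /mexp_coeff mxE mulrAC mulr_sumr.
  by apply: eq_bigr => l _; rewrite mulmx1; ring.
apply: cvg_sum_fin => l; apply: cvgM; last exact: cvg_cst.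
by rewrite mexp_coord; exact: is_cvg_pseries_mexp_coeff.
Qed.

Lemma limn_pseries_mexp p A (w : 'M[R]_(m, p)) i j t :
  limn (pseries (mexp_coeff A w i j) t) = (mexp (t *: A) *m w) i j.
Proof. by apply/cvg_lim => //; exact: cvg_pseries_mexp. Qed.

Lemma is_derive_mexp p A (w : 'M[R]_(m, p)) i j (t : R) :
  is_derive t (1 : R) (fun t => (mexp (t *: A) *m w) i j) ((mexp (t *: A) *m (A
    *m w)) i j).
Proof.
rewrite -limn_pseries_mexp -pseries_diffs_mexp_coeff.
rewrite (_ : (fun _ => _) = fun x => limn (pseries (mexp_coeff A w i j) x));
  last first.
  by apply/funext => x; rewrite limn_pseries_mexp.
(* The series converge everywhere, so any radius beyond |t| serves. *)
apply: (@pseries_snd_diffs _ _ (`|t| + 1));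
  rewrite ?pseries_diffs_mexp_coeff; try exact: is_cvg_pseries_mexp_coeff.
by rewrite [ltRHS]ger0_norm ?ltrDl// addr_ge0.
Qed.

Lemma mexp_eigenmx p A (y : 'M[R]_(m, p)) s t :
  A *m y = s *: y -> mexp (t *: A) *m y = expR (s * t) *: y.
Proof.
move=> Ay; have AXy k : A ^+ k *m y = s ^+ k *: y.
  elim: k => [|k ih]; first by rewrite !expr0 mul1mx scale1r.
  by rewrite exprSr exprS -mulmxE -mulmxA Ay -scalemxAr ih scalerA.
apply/matrixP => i j; rewrite -limn_pseries_mexp [RHS]mxE mulrC.
apply/cvg_lim => //.
rewrite (_ : pseries _ t = y i j *: series (exp_coeff (s * t))); last first.
  apply/funext => n; rewrite /pseries /series/= -[RHS]/(_ * _) mulr_sumr.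
  by apply: eq_bigr => k _; rewrite /mexp_coeff AXy mxE /exp_coeff/= exprMn;
    ring.
by apply: cvgZr; exact: is_cvg_series_exp_coeff.
Qed.

Lemma cvg_taylor_sol A V t i j :
  (fun n => taylor_sol A V n t i j) @ \oo --> (mexp (t *: A) *m V) i j.
Proof.
(* [taylor_sol] includes the term k = n while a partial sum of [pseries] stops before its index,
   hence the shift. *)
rewrite (_ : (fun _ => _) = fun n => pseries (mexp_coeff A V i j) t n.+1).
  by rewrite (cvg_shiftS (pseries (mexp_coeff A V i j) t));
    exact: cvg_pseries_mexp.
apply/funext => n; rewrite /taylor_sol /pseries /series/= summxE big_mkord.
by apply: eq_bigr => k _; rewrite mxE /mexp_coeff; ring.
Qed.

(** The squared norm is a finite sum of products of entries, so it passes to the entrywise limit. *)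
Lemma fnorm_lim_le (f : nat -> 'M[R]_m) (L : 'M[R]_m) (b : R) :
  (forall i j, (fun k => f k i j) @ \oo --> L i j) ->
  (forall k, fnorm (f k) <= b) -> fnorm L <= b.
Proof.
move=> fL fb; have b0 : 0 <= b := le_trans (fnorm_ge0 _) (fb 0%N).
rewrite -ler_sqr ?nnegrE ?fnorm_ge0// fnorm_sqr mxdotE.
have : (fun k => mxdot (f k) (f k)) @ \oo --> mxdot L L.
  rewrite mxdotE; under eq_fun do rewrite mxdotE.
  by apply: cvg_sum_fin => p; apply: cvgM; exact: fL.
move=> fcvg; rewrite -mxdotE -(cvg_lim _ fcvg)//; apply: limr_le.
  by apply/cvg_ex; eexists; exact: fcvg.
by apply: nearW => k; rewrite -fnorm_sqr ler_sqr ?nnegrE ?fnorm_ge0.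
Qed.

(** As (n + 1)! k! <= (n + 1 + k)!, each tail term is at most the term of index n + 1 times the term
    of index k of the exponential series. *)
Lemma fnorm_taylor_sol_diff_le A V n k t : 0 <= t ->
  fnorm (taylor_sol A V (n + k) t - taylor_sol A V n t) <=
  exp_coeff (fnorm A * t) n.+1 * series (exp_coeff (fnorm A * t)) k * fnorm V.
Proof.
move=> t0; have at0 : 0 <= fnorm A * t by rewrite mulr_ge0 ?fnorm_ge0.
elim: k => [|k ih]; first by rewrite addn0 subrr fnorm0 /series/= big_nil mulr0
  mul0r.
rewrite addnS /taylor_sol big_ord_recr -/(taylor_sol A V (n + k) t)/= addrAC.
rewrite (le_trans (fnorm_triangle _ _))// seriesSr mulrDr mulrDl lerD//.
rewrite fnormZ normrM normfV normrX normr_nat (ger0_norm t0).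
rewrite mulrC mulrA.
apply: (@le_trans _ _ ((fnorm A * t) ^+ (n + k).+1 / (n + k).+1`!%:R * fnorm
  V)).
  rewrite exprMn [leRHS]mulrAC ler_wpM2r ?invr_ge0//.
  by rewrite [leRHS]mulrAC ler_wpM2r ?exprn_ge0// fnorm_mulXmx.
rewrite ler_wpM2r ?fnorm_ge0// /exp_coeff/= mulrACA -exprD -invfM addSn.
rewrite ler_wpM2l ?exprn_ge0// lef_pV2 ?posrE ?mulr_gt0 ?ltr0n ?fact_gt0//.
rewrite -natrM ler_nat -addSn -(@bin_fact (n.+1 + k) k) ?leq_addl// addnK.
by rewrite [leqLHS]mulnC leq_pmull// bin_gt0 leq_addl.
Qed.

(** Bounding the partial sums by e^{|A| t} makes the previous estimate uniform in k; then let k tend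
    to infinity. *)
Lemma fnorm_taylor_rest_le A V n t : 0 <= t ->
  fnorm (mexp (t *: A) *m V - taylor_sol A V n t) <=
  exp_coeff (fnorm A * t) n.+1 * expR (fnorm A * t) * fnorm V.
Proof.
move=> t0; have at0 : 0 <= fnorm A * t by rewrite mulr_ge0 ?fnorm_ge0.
apply: (@fnorm_lim_le (fun k => taylor_sol A V (n + k) t - taylor_sol A V n t)).
  move=> i j; rewrite [X in _ --> X]mxE; under eq_fun do rewrite mxE.
  apply: cvgD; last by rewrite mxE; exact: cvg_cst.
  under eq_fun do rewrite addnC.
  by have := @cvg_taylor_sol A V t i j; rewrite -(cvg_shiftn n).
move=> k; rewrite (le_trans (fnorm_taylor_sol_diff_le _ _ _ _ t0))//.
apply: ler_wpM2r; first exact: fnorm_ge0.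
apply: ler_wpM2l; first by rewrite /exp_coeff/= divr_ge0 ?exprn_ge0.
apply: nondecreasing_cvgn_le; last exact: is_cvg_series_exp_coeff.
by apply: nondecreasing_series => ? _ _;
  rewrite /exp_coeff/= divr_ge0 ?exprn_ge0.
Qed.

End MatrixExponential.

(** * Exponential decay along the non-principal eigenvalues *)

(** The margin e between the rate d of the source and the rate d - e of the homogeneous part keeps
    the bound at rate d, with no polynomial factor. *)
Lemma gronwall (R : realType) (phi dphi : R -> R) (d e L : R) :
  (forall t, is_derive (t : R) (1 : R) phi (dphi t)) -> 0 < e -> 0 <= L -> 0 <=
    phi 0 ->
  (forall t, 0 <= t -> dphi t <= (d - e) * phi t + L * expR (d * t)) ->
  forall t, 0 <= t -> phi t <= (phi 0 + L / e) * expR (d * t).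
Proof.
move=> phiD e0 L0 phi0 dphi_le t t0.
(* Integrating factor times phi, minus a primitive of the transformed source: by hypothesis h is
   nonincreasing on the nonnegative axis. *)
pose h := (fun x => expR ((e - d) * x) * phi x - L / e * expR (e * x)).
have expD (c x : R) : is_derive x (1 : R) (fun y => expR (c * y)) (c * expR (c
  * x)).
  have cD : is_derive x (1 : R) (fun y => c * y) c.
    by apply: is_derive_eq; exact: mulr1.
  by rewrite mulrC; exact: (is_derive1_comp (f := expR)).
pose dh x := expR ((e - d) * x) * dphi x + phi x * ((e - d) * expR ((e - d) *
  x))
  - L * expR (e * x).
have hD x : is_derive x (1 : R) h (dh x).
  have eD := expD e x; have edD := expD (e - d) x; have pD := phiD x.
  apply: is_derive_eq.
  rewrite /dh; congr (_ + _ - _).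
  by rewrite -[LHS]/(_ * _) mulrA divfK// gt_eqF.
have h_le : h t <= h 0.
  have hc : {within `[0, t], continuous h}.
    apply: continuous_subspaceT => x; apply: differentiable_continuous.
    by apply/derivable1_diffP; case: (hD x).
  have hd x : x \in `]0, t[ -> derivable h x 1 by move=> _; case: (hD x).
  apply: (ler0_derive1_le_cc hd _ hc); rewrite ?in_itv/= ?lexx ?t0//.
  move=> x; rewrite in_itv/= => /andP[x0 _].
  rewrite derive1E; have [_ ->] := hD x; rewrite /dh.
  have E : expR (e * x) = expR ((e - d) * x) * expR (d * x).
    by rewrite -expRD -mulrDl subrK.
  have := dphi_le x (ltW x0); rewrite -subr_ge0 => H.
  have := mulr_ge0 (expR_ge0 ((e - d) * x)) H.
  by rewrite E; lra.
have Et : expR (e * t) = expR ((e - d) * t) * expR (d * t) by rewrite -expRD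
  -mulrDl subrK.
have Et1 : 1 <= expR (e * t) by rewrite -expR0 ler_expR mulr_ge0// ltW.
move: h_le; rewrite /h !mulr0 !expR0 mul1r mulr1 => h_le.
have Le0 : 0 <= L / e by rewrite divr_ge0// ltW.
have pos := expR_gt0 ((e - d) * t).
rewrite -(ler_pM2l pos) mulrCA -Et.
have := mulr_ge0 (addr_ge0 phi0 Le0) (_ : 0 <= expR (e * t) - 1).
rewrite subr_ge0 => /(_ Et1); move: h_le Le0; set q := L / e; nra.
Qed.

Section ComplexParts.
Context {R : realType} {m : nat}.
Implicit Types (A : 'M[R]_m).

(** Treats Re and Im together, as real-linear maps commuting with the real matrix A. *)
Lemma map_complexify_mulmx (f : R[i] -> R) p A (u : 'M[R[i]]_(m, p)) :
  {morph f : x y / x + y} -> f 0 = 0 -> (forall a z, f (a%:C * z) = a * f z) ->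
  map_mx f (complexify A *m u) = A *m map_mx f u.
Proof.
move=> fD f0 fZ; apply/matrixP => i j; rewrite !mxE (big_morph f fD f0).
by apply: eq_bigr => l _; rewrite !mxE fZ.
Qed.

Lemma Re_complexify_mulmx p A (u : 'M[R[i]]_(m, p)) :
  map_mx (@complex.Re R) (complexify A *m u) = A *m map_mx (@complex.Re R) u.
Proof.
apply: map_complexify_mulmx => [[a b] [c d]||a [b c]] //=.
by rewrite mul0r subr0.
Qed.

Lemma Im_complexify_mulmx p A (u : 'M[R[i]]_(m, p)) :
  map_mx (@complex.Im R) (complexify A *m u) = A *m map_mx (@complex.Im R) u.
Proof.
apply: map_complexify_mulmx => [[a b] [c d]||a [b c]] //=.
by rewrite mul0r addr0.
Qed.

Lemma complexifyXB A (a : R) k :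
  (complexify A - a%:C%:M) ^+ k = complexify ((A - a%:M) ^+ k).
Proof.
elim: k => [|k ih]; first by rewrite !expr0 /complexify map_mx1.
by rewrite !exprS ih -!mulmxE /complexify map_mxM map_mxB map_scalar_mx.
Qed.

End ComplexParts.

Section Decay.
Context {R : realType} {m : nat}.
Implicit Types (A : 'M[R]_m).

(* With z(t) = e^{tA} u and (A - mu) u = u', one has z' = mu z + e^{tA} u', so
   |z|^2 obeys a Gronwall inequality whose source term is |e^{tA} u'|^2. *)
Lemma gen_eigenvector_decay A (mu : R[i]) (c : R) k : complex.Re mu < c ->
  forall u : 'cV[R[i]]_m, (complexify A - mu%:M) ^+ k *m u = 0 ->
  exists2 K : R, 0 <= K & forall t : R, 0 <= t ->
    \sum_i ((mexp (t *: A) *m map_mx (@complex.Re R) u) i 0 ^+ 2 +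
            (mexp (t *: A) *m map_mx (@complex.Im R) u) i 0 ^+ 2)
    <= K * expR (2 * c * t).
Proof.
move=> mu_c; elim: k => [|k ih] u.
  rewrite expr0 mul1mx => ->; exists 0 => // t _; rewrite mul0r big1// => i _.
  by rewrite !mxE !big1 ?expr0n ?addr0// => j _; rewrite !mxE mulr0.
pose u' := (complexify A - mu%:M) *m u.
rewrite exprSr -mulmxE -mulmxA => /ih[K K0 u'K].
have uE : complexify A *m u = mu *: u + u' by rewrite /u' mulmxBl mul_scalar_mx
  addrC subrK.
set p := map_mx (@complex.Re R) u; set q := map_mx (@complex.Im R) u.
set p' := map_mx (@complex.Re R) u' in u'K *;
  set q' := map_mx (@complex.Im R) u' in u'K *.
pose a := complex.Re mu; pose b := complex.Im mu.
have Ap : A *m p = a *: p - b *: q + p'.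
  rewrite -Re_complexify_mulmx uE; apply/matrixP => i j; rewrite !mxE.
  have ReMD (x y z : R[i]) : complex.Re (x * y + z) =
    complex.Re x * complex.Re y - complex.Im x * complex.Im y + complex.Re z.
    by move: x y z => [? ?] [? ?] [? ?].
  exact: ReMD.
have Aq : A *m q = b *: p + a *: q + q'.
  rewrite -Im_complexify_mulmx uE; apply/matrixP => i j; rewrite !mxE.
  have ImMD (x y z : R[i]) : complex.Im (x * y + z) =
    complex.Im x * complex.Re y + complex.Re x * complex.Im y + complex.Im z.
    by move: x y z => [? ?] [? ?] [? ?] /=; rewrite [X in X + _]addrC.
  exact: ImMD.
pose g w i (t : R) := (mexp (t *: A) *m w) i (0 : 'I_1).
have gD w i (t : R) : is_derive t (1 : R) (g w i) (g (A *m w) i t) by exact: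
  is_derive_mexp.
pose phi t := \sum_i (g p i t ^+ 2 + g q i t ^+ 2).
pose dphi t := \sum_i (2 * g p i t * g (A *m p) i t + 2 * g q i t * g (A *m q)
  i t).
have phiD (t : R) : is_derive t (1 : R) phi (dphi t).
  have -> : phi = \sum_i (g p i ^+ 2 + g q i ^+ 2) by apply/funext => x;
    rewrite fct_sumE.
  have hD i : is_derive t (1 : R) (g p i ^+ 2 + g q i ^+ 2)
      (2 * g p i t * g (A *m p) i t + 2 * g q i t * g (A *m q) i t).
    have pD := gD p i t; have qD := gD q i t; apply: is_derive_eq.
    by rewrite !expr1.
  exact: (is_derive_sum hD).
have phi0 : 0 <= phi 0 by apply: sumr_ge0 => i _; rewrite addr_ge0 ?sqr_ge0.
have e0 : 0 < c - a by rewrite subr_gt0.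
(* In the derivative of phi the terms in b cancel, and 2 x x' <= (c - a) x^2 + x'^2 / (c - a). The
   rate becomes 2a + (c - a) = 2c - (c - a), so Gronwall applies with d = 2c, e = c - a and L = K /
   (c - a). *)
exists (phi 0 + (K / (c - a)) / (c - a)).
  by rewrite addr_ge0// !divr_ge0// ltW.
move=> t; apply: (gronwall phiD e0) => //; first by rewrite divr_ge0// ltW.
move=> {}t t0; have := u'K t t0;
  rewrite -(ler_pM2l (_ : 0 < (c - a)^-1)) ?invr_gt0// => H.
rewrite -[K / _ * _]mulrA mulrCA in H *.
rewrite -lerBlDl (le_trans _ H)//.
rewrite /dphi /phi !mulr_sumr -sumrB; apply: ler_sum => i _.
have -> : g (A *m p) i t = a * g p i t - b * g q i t + g p' i t.
  by rewrite Ap /g !mulmxDr mulmxN -!scalemxAr !mxE.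
have -> : g (A *m q) i t = b * g p i t + a * g q i t + g q' i t.
  by rewrite Aq /g !mulmxDr -!scalemxAr !mxE.
rewrite -/(g p' i t) -/(g q' i t).
move: (g p i t) (g q i t) (g p' i t) (g q' i t) => x y x' y'.
rewrite -(ler_pM2l e0) mulrA mulfV ?gt_eqF// mul1r.
have := sqr_ge0 ((c - a) * x - x'); have := sqr_ge0 ((c - a) * y - y').
by nra.
Qed.

Lemma gen_eigenspace_parts_decay A (mu : R[i]) (c : R) (w : 'cV[R]_m) :
  complex.Re mu < c -> gen_eigenspace_parts A mu w ->
  exists K : R, forall (t : R) i, 0 <= t -> `|(mexp (t *: A) *m w) i 0| <= K *
    expR (c * t).
Proof.
move=> mu_c [u [k [_ /(gen_eigenvector_decay mu_c)[K K0 uK] wE]]].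
exists (Num.sqrt K) => t i t0.
rewrite -ler_sqr ?nnegrE ?mulr_ge0 ?sqrtr_ge0 ?expR_ge0// real_normK
  ?num_real//.
rewrite exprMn sqr_sqrtr// -expRM_natl mulrA (le_trans _ (uK t t0))//.
rewrite (bigD1 i)//= -[leLHS]addr0; apply: lerD; last first.
  by apply: sumr_ge0 => j _; rewrite addr_ge0 ?sqr_ge0.
by case: wE => ->; rewrite ?lerDl ?lerDr sqr_ge0.
Qed.

Lemma complementary_decay A (c : R) (w : 'cV[R]_m) :
  (forall mu, spectrum A mu -> mu <> (spectral_abscissa A)%:C -> complex.Re mu
    < c) ->
  complementary_space A w ->
  exists K : R, forall (t : R) i, 0 <= t -> `|(mexp (t *: A) *m w) i 0| <= K *
    expR (c * t).
Proof.
move=> gap [ws + ->] {w}; elim: ws => [_|x ws ih xws].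
  by exists 0 => t i _; rewrite big_nil mulmx0 mxE normr0 mul0r.
have [mu [sp mus xmu]] := xws x (mem_head _ _).
have [K1 xK] := gen_eigenspace_parts_decay (gap mu sp mus) xmu.
have [|K2 wsK] := ih; first by move=> y yws; apply: xws; rewrite inE yws orbT.
exists (K1 + K2) => t i t0; rewrite big_cons mulmxDr mxE mulrDl.
by rewrite (le_trans (ler_normD _ _))// lerD ?xK ?wsK.
Qed.

End Decay.

(** * Primary decomposition and the principal projection *)

Lemma char_poly_tr (R : comNzRingType) n (A : 'M[R]_n) : char_poly A^T =
  char_poly A.
Proof. by rewrite /char_poly -det_tr /char_poly_mx linearB /= tr_scalar_mx
  map_trmx trmxK. Qed.

Lemma trmx_exp (R : comNzRingType) n (A : 'M[R]_n) k : (A ^+ k)^T = A^T ^+ k.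
Proof.
elim: k => [|k ih]; first by rewrite !expr0 trmx1.
by rewrite exprS exprSr -!mulmxE trmx_mul ih.
Qed.

(* [eigenvalue] and [kermxpoly] are about rows, whence the transposes. *)
Lemma gen_eigenvector_decomposition (F : closedFieldType) m (A : 'M[F]_m) (v :
  'cV[F]_m) :
  exists k n (r : 'I_n -> F) (x : 'I_n -> 'cV[F]_m),
    [/\ (0 < k)%N, v = \sum_i x i &
        forall i, eigenvalue A (r i) /\ (A - (r i)%:M) ^+ k *m x i = 0].
Proof.
case: m A v => [|m] A v.
  exists 1%N, 0%N, (fun=> 0), (fun=> 0); split=> // [|[]//].
  by rewrite [LHS]flatmx0 [RHS]flatmx0.
have [rs] := closed_field_poly_normal (char_poly A^T).
rewrite (monicP (char_poly_monic _)) scale1r => charE.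
pose us := undup rs; pose r (i : 'I_(size us)) := us`_i.
pose P i := ('X - (r i)%:P) ^+ count_mem (r i) rs.
have charP : char_poly A^T = \prod_i P i.
  by rewrite charE -(prodr_undup_exp_count rs xpredT) (big_nth 0) big_mkord.
have copP : {in predT &, forall i j, j != i -> coprimep (P i) (P j)}.
  move=> i j _ _ ji; rewrite coprimep_expr ?coprimep_expl// coprimep_XsubC
    root_XsubC.
  by rewrite nth_uniq ?undup_uniq.
(* The minimal polynomial divides the characteristic one, whose kernel is therefore the whole space;
   coprimality splits it. *)
have : (v^T <= \sum_i kermxpoly A^T (P i))%MS.
  rewrite -(kermxpoly_prod A^T copP) -charP (kermxpoly_min (mxminpoly_dvd_char
    _)).
  exact: submx1.
move=> /sub_sumsmxP[u uE].
(* One positive exponent for all eigenvalues, at least as large as every multiplicity. *)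
exists (size rs).+1, (size us), r, (fun i => (u i *m kermxpoly A^T (P i))^T);
  split=> //.
  by rewrite -[LHS]trmxK uE linear_sum.
move=> i; split.
  rewrite eigenvalue_root_char -char_poly_tr charE root_prod_XsubC -mem_undup.
  exact: mem_nth.
apply: trmx_inj; rewrite trmx_mul trmxK trmx0 trmx_exp linearB /= tr_scalar_mx.
have le_count : (count_mem (r i) rs <= (size rs).+1)%N by rewrite leqW//
  count_size.
rewrite -(subnKC le_count) exprD -mulmxE mulmxA -(mulmxA (u i)).
suff -> : kermxpoly A^T (P i) *m (A^T - (r i)%:M) ^+ count_mem (r i) rs = 0.
  by rewrite mulmx0 mul0mx.
have -> : (A^T - (r i)%:M) ^+ count_mem (r i) rs = horner_mx A^T (P i).
  by rewrite /P rmorphXn rmorphB /= horner_mx_X horner_mx_C.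
exact: mulmx_ker.
Qed.

Section PrincipalProjection.
Context {R : realType} {m : nat}.
Implicit Types (A : 'M[R]_m) (v : 'cV[R]_m).

(** Decompose v over the complex numbers and take real parts. Since A - s is real, the real parts of
    the components at s lie in the real generalized eigenspace; the others form the complementary
    part. *)
Lemma principal_decomposition A v :
  exists y, principal_space A y /\ complementary_space A (v - y).
Proof.
have [k [n [r [x [k0 vE xE]]]]] :=
  gen_eigenvector_decomposition (complexify A) (map_mx (real_complex R) v).
set s := spectral_abscissa A.
pose Rex i := map_mx (@complex.Re R) (x i).
have {}vE : v = \sum_i Rex i.
  apply/matrixP => a b; rewrite summxE.
  have := congr1 (fun M : 'cV[R[i]]_m => complex.Re (M a b)) vE;
    rewrite mxE /= summxE => ->.
  rewrite (big_morph (@complex.Re R) (id1 := 0) (op1 := +%R))//;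
    last by move=> [? ?] [? ?].
  by apply: eq_bigr => i _; rewrite mxE.
exists (\sum_(i | r i == s%:C) Rex i); split.
  exists k => //; rewrite mulmx_sumr big1// => i /eqP ris.
  rewrite -Re_complexify_mulmx -complexifyXB -ris; have [_ ->] := xE i.
  by apply/matrixP => a b; rewrite !mxE.
exists [seq Rex i | i <- index_enum 'I_n & r i != s%:C].
  move=> _ /mapP[i +  ->]; rewrite mem_filter => /andP[/eqP ris _].
  have [ei xi] := xE i.
  exists (r i); split=> //; exists (x i), k; split=> //; by left.
by rewrite big_map big_filter vE [X in X - _](bigID (fun i => r i == s%:C))/=
  addrAC subrr add0r.
Qed.

(** A candidate exists, so the value chosen by [xget] is one and the default 0 does not occur. *)
Lemma principal_projP A v :
  principal_space A (principal_proj A v) /\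
  complementary_space A (v - principal_proj A v).
Proof.
have [y yP] := principal_decomposition A v.
exact: (@xgetPex _ 0 [set y | principal_space A y /\ complementary_space A (v -
  y)] (ex_intro _ y yP)).
Qed.

End PrincipalProjection.

(** * Asymptotics of e^{tA} V *)

Section PrincipalPart.
Context {R : realType} {m : nat}.
Variables (A V : 'M[R]_m).
Let s := spectral_abscissa A.
Let Y := principal_part A V.

Lemma mulmx_principal_part : semisimple_at A s -> A *m Y = s *: Y.
Proof.
move=> ssA; apply/matrixP => i j; rewrite !mxE.
have [pj _] := principal_projP A (col j V).
have : real_eigenspace A s (principal_proj A (col j V)) by rewrite -ssA.
rewrite /real_eigenspace /= mulmxBl mul_scalar_mx => /eqP;
  rewrite subr_eq0 => /eqP.
move=> /matrixP/(_ i 0); rewrite !mxE => <-.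
by apply: eq_bigr => l _; rewrite mxE.
Qed.

(** As A Y = s Y, the difference is e^{tA} (V - Y), whose columns start in the complementary space.
    The rate s - delta lies strictly above s - 2 delta, as the decay estimate requires. *)
Lemma principal_part_asymptotics (delta : R) : 0 < delta ->
  (forall mu, spectrum A mu -> mu <> s%:C -> complex.Re mu <= s - 2 * delta) ->
  semisimple_at A s ->
  exists2 K : R, 0 <= K & forall t : R, 0 <= t ->
    fnorm (mexp (t *: A) *m V - expR (s * t) *: Y) <= K * expR ((s - delta) *
      t).
Proof.
move=> delta0 gap ssA.
have decay j : exists K : R, forall (t : R) i, 0 <= t ->
    `|(mexp (t *: A) *m (V - Y)) i j| <= K * expR ((s - delta) * t).
  have [_ cj] := principal_projP A (col j V).
  have [|K jK] := complementary_decay (c := s - delta) _ cj.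
    by move=> mu sp mus; rewrite (le_lt_trans (gap mu sp mus))//; lra.
  exists K => t i /(jK t i); congr (`|_| <= _); rewrite !mxE.
  by apply: eq_bigr => l _; rewrite !mxE.
have [K jK] := fin_all_exists decay.
pose K' := \sum_j `|K j|.
exists (m%:R * K'); first by rewrite mulr_ge0// sumr_ge0.
move=> t t0; rewrite -(mexp_eigenmx _ (mulmx_principal_part ssA)) -mulmxBr
  -mulrA.
apply: fnorm_le_coord => i j; rewrite (le_trans (jK j t i t0))//.
rewrite ler_wpM2r ?expR_ge0// (le_trans (ler_norm _))// /K' (bigD1 j)//=.
by rewrite lerDl sumr_ge0.
Qed.

End PrincipalPart.

(** * Rayleigh quotients and the final estimates *)

Lemma eigenmx_le_fnorm (R : realType) m (A Y : 'M[R]_m) (s : R) :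
  A *m Y = s *: Y -> Y != 0 -> `|s| <= fnorm A.
Proof.
move=> AY; rewrite -fnorm_gt0 => Y0.
by rewrite -(ler_pM2r Y0) -fnormZ -AY fnorm_mulmx.
Qed.

Lemma rayleigh_le (R : realType) m (A X Y : 'M[R]_m) (s : R) :
  A *m Y = s *: Y -> `|s| <= fnorm A -> X != 0 -> 
  `|(fnorm X ^+ 2)^-1 * mxdot (A *m X) X - s| <=
  2 * fnorm A * fnorm ((fnorm X)^-1 *: X - Y).
Proof.
move=> AY sA; rewrite -fnorm_gt0 => X0.
set x := (fnorm X)^-1 *: X.
have x1 : fnorm x = 1 by rewrite fnormZ normfV ger0_norm ?fnorm_ge0// mulVf//
  gt_eqF.
have -> : (fnorm X ^+ 2)^-1 * mxdot (A *m X) X - s = mxdot (A *m x - s *: x) x.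
  rewrite mxdotDl -scaleNr mxdotZl -(fnorm_sqr x) x1 expr1n mulr1;
    congr (_ - _).
  rewrite /x -scalemxAr mxdotZl (mxdotC _ (_ *: X)) mxdotZl (mxdotC X) mulrA.
  by rewrite -invfM -expr2.
rewrite (le_trans (normr_mxdot_le _ _))// x1 mulr1.
have -> : A *m x - s *: x = A *m (x - Y) - s *: (x - Y).
  by rewrite mulmxBr AY scalerBr opprB addrA subrK.
rewrite (le_trans (fnorm_triangle _ _))// fnormN fnormZ mulr2n mulrDl mul1r
  mulrDl.
by rewrite lerD ?fnorm_mulmx// ler_wpM2r ?fnorm_ge0.
Qed.

(** The powers N^N and e^N cancel for N = n + 1, leaving the Taylor coefficient (|A| t)^N / N! of
    the remainder estimate. *)
Lemma vartheta_stirling_gap (R : realType) m (A : 'M[R]_m) (kappa t : R) n :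
  vartheta A kappa n t * stirling_gap n =
  kappa^-1 * expR (2 * fnorm A * t) * exp_coeff (fnorm A * t) n.+1.
Proof.
rewrite /vartheta /stirling_gap -[LHS]mulrA; congr (_ * _).
rewrite -[RHS]/(_ / _).
have -> : expR n.+1%:R = expR 1 ^+ n.+1 :> R by rewrite -expRM_natl mulr1.
rewrite expr_div_n -(mulrA (expR 1)) exprMn.
by field; rewrite !pnatr_eq0 -lt0n fact_gt0 !expf_neq0 ?gt_eqF ?expR_gt0 ?ltr0n.
Qed.

Theorem theorem4p2 (R : realType) :
  exists2 o : nat -> R, o @ \oo --> (0 : R) &
  forall (m : nat) (A V : 'M[R]_m) (delta kappa : R),
    let s := spectral_abscissa A in
    let Y := principal_part A V in
    let X := taylor_sol A V in
    perron_like A ->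
    0 < delta ->
    (forall mu, spectrum A mu -> mu <> s%:C ->
       complex.Re mu <= s - 2 * delta) ->
    V \in unitmx ->
    fnorm V = 1 ->
    semisimple_at A s ->
    0 < kappa ->
    (forall t : R, 1 <= t ->
       kappa <= expR (- (s * t)) * fnorm (mexp (t *: A) *m V)) ->
    kappa <= fnorm Y ->
    exists B1 B2 : R, [/\ 0 < B1, 0 < B2 &
      forall (n : nat) (t : R), 1 <= t -> X n t != 0 ->
        fnorm ((fnorm (X n t))^-1 *: X n t - (fnorm Y)^-1 *: Y)
          <= B1 * expR (- (delta * t)) + vartheta A kappa n t * o n
        /\
        `| (fnorm (X n t) ^+ 2)^-1 * mxdot (A *m X n t) (X n t) - s |
          <= B2 * expR (- (delta * t))
             + fnorm A * vartheta A kappa n t * o n].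
Proof.
(* Chosen before all other data, so it depends on n only. Normalizing costs a factor 2 and the
   Rayleigh quotient another 2. *)
exists (fun n => 4 * stirling_gap n).
  by rewrite -[X in _ --> X](mulr0 4); apply: cvgMr; exact: cvg_stirling_gap.
move=> m A V delta kappa s Y X _ delta0 gap _ V1 ssA kappa0 W_ge Y_ge.
have Y_neq0 : Y != 0 by rewrite -fnorm_gt0 (lt_le_trans kappa0).
have AY : A *m Y = s *: Y by exact: mulmx_principal_part.
have sA : `|s| <= fnorm A := eigenmx_le_fnorm AY Y_neq0.
have [K K0 WK] := principal_part_asymptotics V delta0 gap ssA.
pose B : R := 2 * (K / kappa).
have B0 : 0 <= B by rewrite mulr_ge0// divr_ge0// ltW.
have bound n t : 1 <= t -> X n t != 0 ->
    fnorm ((fnorm (X n t))^-1 *: X n t - (fnorm Y)^-1 *: Y)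
    <= B * expR (- (delta * t)) + vartheta A kappa n t * (2 * stirling_gap n).
  move=> t1 Xn0; have t0 : 0 <= t := le_trans ler01 t1.
  set W := mexp (t *: A) *m V.
  have W_gt : kappa * expR (s * t) <= fnorm W.
    by have := W_ge t t1; rewrite expRN mulrC ler_pdivlMr ?expR_gt0.
  have W_neq0 : W != 0 by rewrite -fnorm_gt0 (lt_le_trans _ W_gt)// mulr_gt0
    ?expR_gt0.
  have esY_neq0 : expR (s * t) *: Y != 0 by rewrite scaler_eq0 negb_or gt_eqF
    ?expR_gt0.
  (* Normalization ignores the positive factor e^{st}, so Y may be replaced by the matrix that W
     approaches. *)
  have -> : (fnorm Y)^-1 *: Y = (fnorm (expR (s * t) *: Y))^-1 *: (expR (s * t)
    *: Y).
    rewrite fnormZ ger0_norm ?expR_ge0// scalerA invfM mulrAC mulVf ?mul1r//.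
    by rewrite gt_eqF ?expR_gt0.
  rewrite -(subrKA ((fnorm W)^-1 *: W)) (le_trans (fnorm_triangle _ _))// addrC.
  apply: lerD.
    (* Distance from W to e^{st} Y: dividing K e^{(s - delta) t} by e^{st} |Y| >= kappa e^{st}
       leaves e^{-delta t}. *)
    rewrite (le_trans (fnorm_normalize_le W_neq0 esY_neq0))// /B -mulrA
      ler_pM2l//.
    rewrite ler_pdivrMr ?fnorm_gt0// (le_trans (WK t t0))//.
    rewrite fnormZ ger0_norm ?expR_ge0// mulrBl expRD.
    have YK : 1 <= fnorm Y / kappa by rewrite ler_pdivlMr ?mul1r.
    have KE : 0 <= K * (expR (s * t) * expR (- (delta * t))) by rewrite
      !mulr_ge0 ?expR_ge0.
    have := ler_wpM2l KE YK; rewrite mulr1; lra.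
  (* Distance from X_n to W: the Taylor remainder is divided by |W|, which is bounded below through
     kappa. *)
  rewrite (le_trans (fnorm_normalize_le Xn0 W_neq0))// [leRHS]mulrCA ler_pM2l//.
  rewrite ler_pdivrMr ?fnorm_gt0// fnormB.
  rewrite (le_trans (fnorm_taylor_rest_le _ _ _ t0))// V1 mulr1.
  rewrite vartheta_stirling_gap.
  set c := exp_coeff _ _; have c0 : 0 <= c.
    by rewrite /c /exp_coeff/= divr_ge0 ?exprn_ge0 ?mulr_ge0 ?fnorm_ge0.
  rewrite (mulrAC _ c) [leRHS]mulrC ler_wpM2l//.
  (* Here e^{at} <= e^{2at} e^{st} with a = |A|, because s >= -a. *)
  apply: (@le_trans _ _ (kappa^-1 * expR (2 * fnorm A * t) * (kappa * expR (s *
    t)))).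
    rewrite mulrACA mulVf ?gt_eqF// mul1r -expRD ler_expR -mulrDl ler_wpM2r//.
    by move: sA; rewrite ler_norml; lra.
  by rewrite ler_wpM2l// mulr_ge0 ?expR_ge0// invr_ge0 ltW.
(* Adding 1 makes the constants positive even when B = 0; the factor 2 |A| comes from
   [rayleigh_le]. *)
exists (B + 1), (2 * fnorm A * B + 1); split.
- by rewrite ltr_wpDl.
- by rewrite ltr_wpDl// mulr_ge0// mulr_ge0// fnorm_ge0.
move=> n t t1 Xn0; have bnd := bound n t t1 Xn0.
have e0 := expR_ge0 (- (delta * t)).
have th0 : 0 <= vartheta A kappa n t * stirling_gap n.
  have at0 : 0 <= fnorm A * t by rewrite mulr_ge0 ?fnorm_ge0// (le_trans ler01).
  rewrite vartheta_stirling_gap mulr_ge0//; last by rewrite exp_coeff_ge0.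
  by rewrite mulr_ge0 ?expR_ge0// invr_ge0 ltW.
split; first lra.
rewrite (le_trans (rayleigh_le (Y := (fnorm Y)^-1 *: Y) _ sA Xn0))//.
  by rewrite -scalemxAr AY !scalerA mulrC.
have a0 : 0 <= 2 * fnorm A by rewrite mulr_ge0 ?fnorm_ge0.
have := ler_wpM2l a0 bnd; lra.
Qed.
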